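(* Let $n$ be an arbitrary positive integer, let $P_1(\cos\theta,\sin\theta)=A_1^1\cos\theta+B_1^1\sin\theta$ with real numbers $A_1^1,B_1^1$ satisfying $(A_1^1)^2+(B_1^1)^2\neq 0$, let $\bar P_1=\bar P_1(\theta)=A_1^1\sin\theta-B_1^1\cos\theta$, and let $P_n(\cos\theta,\sin\theta)=\sum_{i+j=n}p_{ij}\cos^i\theta\,\sin^j\theta$ with real constants $p_{ij}$. Then, for the equation $$\frac{dr}{d\theta}=r\left(P_1(\cos\theta,\sin\theta)\,r+P_n(\cos\theta,\sin\theta)\,r^n\right),$$ $r=0$ is a center if and only if $$\int_0^{2\pi}\bar P_1(\theta)^j\,P_n(\cos\theta,\sin\theta)\,d\theta=0\qquad (j=0,1,2,\dots,n).$$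
   Context: For a scalar differential equation $\frac{dr}{d\theta}=F(\theta,r)$ with $F$ $2\pi$-periodic in $\theta$ and $F(\theta,0)\equiv 0$, one says that $r=0$ is a center if all solutions $r(\theta)$ near the solution $r\equiv 0$ are periodic, with $r(0)=r(2\pi)$.
   Formalization: For n=1 the form P_n is taken to be P_1 itself (p_10=A_1^1, p_01=B_1^1), since with independent coefficients the claim fails at n=1: P_1=cos θ, P_n=sin θ gives a center, but the integral for j=1 equals π. *)

(* Defs.v *)
From Stdlib Require Import Reals.
From Coquelicot Require Import Coquelicot.
Open Scope R_scope.

Definition is_solution (F : R -> R -> R) (r : R -> R) : Prop :=
  forall t : R, is_derive r t (F t (r t)).

Definition periodic_2PI (r : R -> R) : Prop :=
  forall t : R, r (t + 2 * PI) = r t.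

(* [F t r] is the right-hand side of dr/dt = F(t, r), with F 2PI-periodic in t
   and F(t, 0) = 0.  "Near r = 0" is measured at t = 0.  The existence clause
   prevents the condition on all solutions from holding vacuously because
   solutions blow up; periodicity of period 2PI includes r 0 = r (2 PI). *)
Definition is_center (F : R -> R -> R) : Prop :=
  exists eps : R, 0 < eps /\
    forall r0 : R, Rabs r0 < eps ->
      (exists r : R -> R, is_solution F r /\ r 0 = r0) /\
      (forall r : R -> R, is_solution F r -> r 0 = r0 -> periodic_2PI r).

Definition P1 (A B : R) (t : R) : R := A * cos t + B * sin t.

Definition P1bar (A B : R) (t : R) : R := A * sin t - B * cos t.

Definition Pform (n : nat) (p : nat -> nat -> R) (t : R) : R :=
  sum_f_R0 (fun i => p i (n - i)%nat * cos t ^ i * sin t ^ (n - i)) n.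

(* Main.v *)
(* With a = P1 and b = P1bar one has b' = a and a^2 + b^2 = A^2 + B^2, so every
   form of degree n is f(b) + a g(b) with polynomials f of degree <= n and g.

   If the moments vanish, then 0 = int f(b) P_n = int f(b)^2, because int a h(b) = 0
   for every continuous h.  Hence P_n = a g(b), the solutions with small initial
   values factor as r = phi(b) with phi' = phi^2 + g phi^(n+1), and they are periodic.

   Conversely, for n = 1 the moments vanish since P_n = a.  For n > 1, let m = n - 1
   and let r > 0 be a small periodic solution.  For w = 1/r + b one gets
   w' = -P_n r^m, so (w^n)' = -n P_n (w r)^m and int P_n (1 - b/w)^(-m) = 0.
   With y = 1/w(0) one has 1/w = y + O(y^(n+1)), so the Taylor expansion of
   (1 - x)^(-m), whose coefficients c_j are all positive, gives
   sum_(j <= n) c_j y^j int b^j P_n = O(y^(n+1)) for all small y > 0. *)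
Require Import Defs.
From Stdlib Require Import Reals Lra Lia.
From Coquelicot Require Import Coquelicot.
Open Scope R_scope.

(** * Calculus preliminaries, the scalar linear equation, differences of powers *)

Lemma is_derive_0_const (f : R -> R) (a b : R) :
  (forall t, Rmin a b <= t <= Rmax a b -> is_derive f t 0) -> f b = f a.
Proof.
intros H.
destruct (MVT_gen f a b (fun _ => 0)) as [c [_ Hc]].
- intros t Ht. apply H. lra.
- intros t Ht. apply continuity_pt_filterlim.
  apply (ex_derive_continuous f t). exists 0. now apply H.
- lra.
Qed.

Lemma is_derive_RInt_cont (f : R -> R) (a t : R) :
  (forall s, continuous f s) -> is_derive (fun s => RInt f a s) t (f t).
Proof.
intros Hf. apply (is_derive_RInt f (fun s => RInt f a s) a t).
- apply filter_forall. intros s. apply (RInt_correct (V := R_CompleteNormedModule)).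
  apply (ex_RInt_continuous (V := R_CompleteNormedModule)). intros; apply Hf.
- apply Hf.
Qed.

Lemma ex_RInt_cont (f : R -> R) (a b : R) :
  (forall s, continuous f s) -> ex_RInt f a b.
Proof. intros Hf. apply (ex_RInt_continuous (V := R_CompleteNormedModule)). intros; apply Hf. Qed.

(** Integrating factor: [d * exp (- I)] has zero derivative for every primitive [I] of [c].
    Uniqueness and positivity of solutions both reduce to this. *)
Lemma linear_ode (c d : R -> R) :
  (forall t, continuous c t) ->
  (forall t, is_derive d t (c t * d t)) ->
  forall t, d t = d 0 * exp (RInt c 0 t).
Proof.
intros Hc Hd t.
assert (E : forall I : R -> R, (forall s, is_derive I s (c s)) ->
  d t * exp (- I t) = d 0 * exp (- I 0)).
{ intros I HI. apply (is_derive_0_const (fun s => d s * exp (- I s)) 0 t).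
  intros s _.
  pose proof (Hd s) as Hs. pose proof (HI s) as HIs.
  auto_derive.
  - split; [eexists; apply Hs | split; [eexists; apply HIs | easy]].
  - replace (Derive (fun x => d x) s) with (c s * d s)
      by (symmetry; now apply is_derive_unique).
    replace (Derive (fun x => I x) s) with (c s)
      by (symmetry; now apply is_derive_unique).
    ring. }
specialize (E (fun s => RInt c 0 s) (fun s => is_derive_RInt_cont c 0 s Hc)).
simpl in E.
replace (RInt c 0 0) with 0 in E by (symmetry; apply (RInt_point (V := R_CompleteNormedModule))).
rewrite Ropp_0, exp_0, exp_Ropp in E.
pose proof (exp_pos (RInt c 0 t)).
apply (Rmult_eq_reg_r (/ exp (RInt c 0 t))); [|apply Rinv_neq_0_compat; lra].
rewrite E. field. lra.
Qed.

Lemma pow_lipschitz (k : nat) (d x y : R) :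
  Rabs x <= d -> Rabs y <= d ->
  Rabs (x ^ S k - y ^ S k) <= INR (S k) * d ^ k * Rabs (x - y).
Proof.
intros Hx Hy. pose proof (Rabs_pos x).
induction k as [|k IH].
- simpl. rewrite !Rmult_1_r, Rmult_1_l. lra.
- replace (x ^ S (S k) - y ^ S (S k))
    with (x * (x ^ S k - y ^ S k) + (x - y) * y ^ S k) by (simpl; ring).
  eapply Rle_trans; [apply Rabs_triang|].
  rewrite !Rabs_mult, <- RPow_abs.
  assert (Rabs y ^ S k <= d ^ S k) by (apply pow_incr; split; [apply Rabs_pos|easy]).
  assert (Rabs x * Rabs (x ^ S k - y ^ S k) <= d * (INR (S k) * d ^ k * Rabs (x - y)))
    by (apply Rmult_le_compat; try apply Rabs_pos; assumption).
  assert (Rabs (x - y) * Rabs y ^ S k <= Rabs (x - y) * d ^ S k)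
    by (apply Rmult_le_compat_l; [apply Rabs_pos|easy]).
  rewrite (S_INR (S k)). simpl (d ^ S k) in *. nra.
Qed.

(** The sum of all x^i y^(k-i), i.e. the quotient of x^(k+1) - y^(k+1) by x - y written without
    division, so that it stays continuous where x = y. *)
Fixpoint geom_sum (k : nat) (x y : R) : R :=
  match k with O => 1 | S k => x * geom_sum k x y + y ^ S k end.

Lemma pow_sub (k : nat) (x y : R) :
  x ^ S k - y ^ S k = geom_sum k x y * (x - y).
Proof.
induction k as [|k IH]; [simpl; ring|].
replace (x ^ S (S k) - y ^ S (S k))
    with (x * (x ^ S k - y ^ S k) + (x - y) * y ^ S k) by (simpl; ring).
rewrite IH. simpl. ring.
Qed.

Lemma continuous_pow (f : R -> R) (k : nat) (t : R) :
  continuous f t -> continuous (fun s => f s ^ k) t.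
Proof.
intros Hf. induction k as [|k IH].
- apply continuous_const.
- now apply (continuous_mult f (fun s => f s ^ k)).
Qed.

Lemma continuous_geom_sum (k : nat) (f g : R -> R) (t : R) :
  continuous f t -> continuous g t ->
  continuous (fun s => geom_sum k (f s) (g s)) t.
Proof.
intros Hf Hg. induction k as [|k IH].
- apply continuous_const.
- apply (continuous_plus (fun s => f s * geom_sum k (f s) (g s)) (fun s => g s ^ S k)).
  + now apply (continuous_mult f (fun s => geom_sum k (f s) (g s))).
  + now apply continuous_pow.
Qed.

(** * Uniqueness and positivity of solutions *)

Definition abel_rhs (n : nat) (P Q : R -> R) (t r : R) : R :=
  r * (P t * r + Q t * r ^ n).

Lemma solution_continuous (F : R -> R -> R) (r : R -> R) (t : R) :
  is_solution F r -> continuous r t.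
Proof. intros H. apply (ex_derive_continuous r t). eexists. apply H. Qed.

(** Dividing [r1 - r2] out of the difference of the right-hand sides leaves the continuous
    coefficient [c], so the difference solves a homogeneous linear equation and vanishes with its
    initial value. *)
Lemma solution_unique (n : nat) (P Q r1 r2 : R -> R) :
  (forall t, continuous P t) -> (forall t, continuous Q t) ->
  is_solution (abel_rhs n P Q) r1 -> is_solution (abel_rhs n P Q) r2 ->
  r1 0 = r2 0 -> forall t, r1 t = r2 t.
Proof.
intros HP HQ H1 H2 H0 t.
set (c := fun s => P s * (r1 s + r2 s) + Q s * geom_sum n (r1 s) (r2 s)).
cut (r1 t - r2 t = 0); [lra|].
rewrite (linear_ode c (fun s => r1 s - r2 s)).
- rewrite H0. ring.
- intros s. pose proof (solution_continuous _ _ s H1). pose proof (solution_continuous _ _ s H2).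
  apply (continuous_plus (fun s => P s * (r1 s + r2 s)) (fun s => Q s * geom_sum n (r1 s) (r2 s))).
  + apply (continuous_mult P (fun s => r1 s + r2 s)); [apply HP|].
    now apply (continuous_plus r1 r2).
  + apply (continuous_mult Q (fun s => geom_sum n (r1 s) (r2 s))); [apply HQ|].
    now apply continuous_geom_sum.
- intros s. evar_last; [apply (is_derive_minus r1 r2); [apply H1|apply H2]|].
  unfold minus, plus, opp; simpl. unfold abel_rhs, c.
  replace (r1 s * (P s * r1 s + Q s * r1 s ^ n) + - (r2 s * (P s * r2 s + Q s * r2 s ^ n)))
   with (P s * (r1 s + r2 s) * (r1 s - r2 s) + Q s * (r1 s ^ S n - r2 s ^ S n)) by (simpl; ring).
  rewrite pow_sub. ring.
Qed.

(** Along the solution itself the equation is linear, with coefficient P r + Q r^n, so [r] is [r 0]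
    times an exponential. *)
Lemma solution_pos (n : nat) (P Q r : R -> R) :
  (forall t, continuous P t) -> (forall t, continuous Q t) ->
  is_solution (abel_rhs n P Q) r -> 0 < r 0 -> forall t, 0 < r t.
Proof.
intros HP HQ H H0 t.
rewrite (linear_ode (fun s => P s * r s + Q s * r s ^ n) r).
- apply Rmult_lt_0_compat; [easy|apply exp_pos].
- intros s. pose proof (solution_continuous _ _ s H).
  apply (continuous_plus (fun s => P s * r s) (fun s => Q s * r s ^ n)).
  + now apply (continuous_mult P r).
  + apply (continuous_mult Q (fun s => r s ^ n)); [apply HQ|]. now apply continuous_pow.
- intros s. evar_last; [apply H|]. unfold abel_rhs. ring.
Qed.

(** * Existence of small solutions by Picard iteration *)

Lemma abs_RInt_bound (g : R -> R) (a b K : R) :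
  (forall s, continuous g s) ->
  (forall s, Rmin a b <= s <= Rmax a b -> Rabs (g s) <= K) ->
  Rabs (RInt g a b) <= Rabs (b - a) * K.
Proof.
intros Hg HK. destruct (Rle_dec a b) as [h|h].
- rewrite (Rabs_pos_eq (b - a)) by lra.
  apply abs_RInt_le_const; [easy|now apply ex_RInt_cont|].
  intros s Hs. apply HK. rewrite Rmin_left, Rmax_right; lra.
- rewrite <- (opp_RInt_swap g b a) by now apply ex_RInt_cont.
  unfold opp; simpl. rewrite Rabs_Ropp.
  replace (Rabs (b - a)) with (a - b) by (rewrite Rabs_left; lra).
  apply abs_RInt_le_const; [lra|now apply ex_RInt_cont|].
  intros s Hs. apply HK. rewrite Rmin_right, Rmax_left; lra.
Qed.

(** For M >= 0 this is the truncation of [s] to [-M, M]; the formula with absolute values makes its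
    properties linear arithmetic by cases. *)
Definition clamp (M s : R) : R := (Rabs (s + M) - Rabs (s - M)) / 2.

Lemma clamp_id (M s : R) : Rabs s <= M -> clamp M s = s.
Proof.
intros H. apply Rabs_le_between in H. unfold clamp.
rewrite (Rabs_pos_eq (s + M)), (Rabs_left1 (s - M)); lra.
Qed.

Lemma clamp_bound (M s : R) : 0 <= M -> Rabs (clamp M s) <= M.
Proof.
intros H. unfold clamp. apply Rabs_le.
unfold Rabs. destruct (Rcase_abs (s + M)), (Rcase_abs (s - M)); lra.
Qed.

Lemma clamp_lipschitz (M x y : R) : Rabs (clamp M x - clamp M y) <= Rabs (x - y).
Proof.
unfold clamp. apply Rabs_le.
unfold Rabs. repeat destruct Rcase_abs; lra.
Qed.

Lemma lipschitz_continuous (f : R -> R) (K s : R) :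
  0 < K -> (forall t, Rabs (f t - f s) <= K * Rabs (t - s)) -> continuous f s.
Proof.
intros HK H. apply filterlim_locally. intros eps.
assert (Hd : 0 < eps / K) by (apply Rdiv_lt_0_compat; [apply cond_pos|easy]).
exists (mkposreal _ Hd). intros t Ht.
change (Rabs (t - s) < eps / K) in Ht. change (Rabs (f t - f s) < eps).
eapply Rle_lt_trans; [apply H|].
apply (Rmult_lt_compat_l K) in Ht; [|easy].
replace (K * (eps / K)) with (pos eps) in Ht by (field; lra). exact Ht.
Qed.

Lemma continuous_clamp (M s : R) : continuous (clamp M) s.
Proof.
apply (lipschitz_continuous _ 1); [lra|]. intros t. rewrite Rmult_1_l. apply clamp_lipschitz.
Qed.

(** The bounds on [f] are global, so the iterates need not be confined to a region; the factor 4 M L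
    combines the path length 2 M with a contraction ratio 1/2. The bound 2 M C on the displacement
    lets a caller who truncated [f] check that the truncation is inactive along [phi]. *)
Lemma picard_clamped (f : R -> R -> R) (M C L s0 r0 : R) :
  0 < M -> 0 <= C -> 0 <= L -> 4 * M * L <= 1 -> Rabs s0 <= M ->
  (forall phi : R -> R, (forall s, continuous phi s) ->
     forall s, continuous (fun s => f s (phi s)) s) ->
  (forall s x y, Rabs (f s x - f s y) <= L * Rabs (x - y)) ->
  (forall s x, Rabs (f s x) <= C) ->
  exists phi : R -> R,
    phi s0 = r0 /\
    (forall s, Rabs (phi s - r0) <= 2 * M * C) /\
    (forall s, Rabs s < M -> is_derive phi s (f s (phi s))).
Proof.
intros HM HC HL HML Hs0 Hcont Hlip Hbd.
(* Clamping the upper endpoint makes [T] a 1/2-contraction for the sup norm on all of R. *)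
set (T := fun (phi : R -> R) s => r0 + RInt (fun u => f u (phi u)) s0 (clamp M s)).
assert (Hlen : forall s, Rabs (clamp M s - s0) <= 2 * M).
{ intros s. eapply Rle_trans; [apply Rabs_triang|]. rewrite Rabs_Ropp.
  pose proof (clamp_bound M s ltac:(lra)). lra. }
assert (HTc : forall phi, (forall s, continuous phi s) -> forall s, continuous (T phi) s).
{ intros phi Hphi s. unfold T.
  apply (continuous_plus (fun _ => r0)); [apply continuous_const|].
  apply (continuous_comp (clamp M) (fun x => RInt (fun u => f u (phi u)) s0 x)).
  - apply continuous_clamp.
  - apply (ex_derive_continuous (fun x => RInt (fun u => f u (phi u)) s0 x)).
    eexists. apply is_derive_RInt_cont. now apply Hcont. }
assert (HTb : forall phi, (forall s, continuous phi s) -> forall s, Rabs (T phi s - r0) <= 2 * M * C).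
{ intros phi Hphi s. unfold T.
  rewrite Rplus_minus_l.
  eapply Rle_trans; [apply (abs_RInt_bound _ _ _ C)|].
  - now apply Hcont.
  - intros; apply Hbd.
  - apply Rmult_le_compat_r; [easy|apply Hlen]. }
assert (HTl : forall phi psi K, (forall s, continuous phi s) -> (forall s, continuous psi s) ->
  (forall s, Rabs (phi s - psi s) <= K) -> forall s, Rabs (T phi s - T psi s) <= K / 2).
{ intros phi psi K Hphi Hpsi HK s. unfold T.
  assert (HK0 : 0 <= K) by (eapply Rle_trans; [apply Rabs_pos|apply (HK 0)]).
  rewrite Rminus_plus_l_l.
  rewrite <- (RInt_minus (V := R_CompleteNormedModule)) by (apply ex_RInt_cont; now apply Hcont).
  eapply Rle_trans; [apply (abs_RInt_bound _ _ _ (L * K))|].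
  - intros u. apply (continuous_minus (fun u => f u (phi u)) (fun u => f u (psi u))); now apply Hcont.
  - intros u _. eapply Rle_trans; [apply Hlip|]. apply Rmult_le_compat_l; [easy|apply HK].
  - apply Rle_trans with (2 * M * (L * K)); [|nra].
    apply Rmult_le_compat_r; [nra|apply Hlen]. }
set (phi := fix phi k := match k with O => fun _ : R => r0 | S k => T (phi k) end).
assert (Hphic : forall k s, continuous (phi k) s).
{ induction k as [|k IH]; intros s; [apply continuous_const|]. now apply HTc. }
set (K := 2 * M * C).
assert (HK : 0 <= K) by (unfold K; nra).
assert (Hstep : forall k s, Rabs (phi (S k) s - phi k s) <= K * (/ 2) ^ k).
{ induction k as [|k IH]; intros s.
  - simpl. rewrite Rmult_1_r. apply HTb. apply (Hphic O).
  - replace (K * (/ 2) ^ S k) with (K * (/ 2) ^ k / 2) by (simpl; field).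
    apply (HTl (phi (S k)) (phi k)); [apply Hphic|apply Hphic|apply IH]. }
(* The subtracted term is the geometric tail still to come. It closes the induction on [m]; dropping
   it leaves a Cauchy bound uniform in [s]. *)
assert (Hfar : forall k m s, Rabs (phi (k + m)%nat s - phi k s) <= 2 * K * (/ 2) ^ k - 2 * K * (/ 2) ^ (k + m)).
{ intros k m s. induction m as [|m IH].
  - rewrite Nat.add_0_r, Rminus_diag, Rabs_R0. lra.
  - rewrite Nat.add_succ_r.
    replace (phi (S (k + m)) s - phi k s)
      with ((phi (S (k + m)) s - phi (k + m)%nat s) + (phi (k + m)%nat s - phi k s)) by ring.
    eapply Rle_trans; [apply Rabs_triang|].
    pose proof (Hstep (k + m)%nat s). simpl ((/ 2) ^ S (k + m)). lra. }
assert (Hhalf : forall k, 0 < (/ 2) ^ k) by (intros k; apply pow_lt; lra).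
assert (Hlimhalf : forall c, is_lim_seq (fun k => c * (/ 2) ^ k) 0).
{ intros c. replace (Finite 0) with (Rbar_mult c 0) by (simpl; f_equal; ring).
  apply is_lim_seq_scal_l. apply is_lim_seq_geom. rewrite Rabs_pos_eq; lra. }
assert (Hcv : forall s, ex_finite_lim_seq (fun k => phi k s)).
{ intros s. apply ex_lim_seq_cauchy_corr. intros eps.
  (* The factor is 4 because [phi i] and [phi j] each lie within 2 K / 2^N of [phi N]. *)
  pose proof (proj2 (is_lim_seq_spec _ _) (Hlimhalf (4 * K)) eps) as [N HN].
  exists N. intros i j Hi Hj.
  specialize (HN N (le_n _)). rewrite Rminus_0_r in HN.
  rewrite Rabs_pos_eq in HN by (pose proof (Hhalf N); nra).
  pose proof (Hfar N (i - N)%nat s) as H1. pose proof (Hfar N (j - N)%nat s) as H2.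
  replace (N + (i - N))%nat with i in H1 by lia. replace (N + (j - N))%nat with j in H2 by lia.
  pose proof (Hhalf i). pose proof (Hhalf j).
  replace (phi i s - phi j s) with ((phi i s - phi N s) - (phi j s - phi N s)) by ring.
  eapply Rle_lt_trans; [apply Rabs_triang|]. rewrite Rabs_Ropp. nra. }
set (psi := fun s => real (Lim_seq (fun k => phi k s))).
assert (Hpsi : forall s, is_lim_seq (fun k => phi k s) (psi s)).
{ intros s. apply Lim_seq_correct'. apply Hcv. }
assert (Hclose : forall k s, Rabs (psi s - phi k s) <= 2 * K * (/ 2) ^ k).
{ intros k s.
  apply (is_lim_seq_le (fun m => Rabs (phi (m + k)%nat s - phi k s)) (fun _ => 2 * K * (/ 2) ^ k)
     (Finite (Rabs (psi s - phi k s))) (Finite (2 * K * (/ 2) ^ k))).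
  - intros m. rewrite Nat.add_comm. pose proof (Hfar k m s). pose proof (Hhalf (k + m)%nat). nra.
  - apply (is_lim_seq_abs (fun m => phi (m + k)%nat s - phi k s) (Finite (psi s - phi k s))).
    apply is_lim_seq_minus'; [|apply is_lim_seq_const].
    now apply (is_lim_seq_incr_n (fun m => phi m s) k).
  - apply is_lim_seq_const. }
assert (Hpsic : forall s, continuous psi s).
{ intros s. apply filterlim_locally. intros eps.
  assert (He : 0 < eps / 3) by (pose proof (cond_pos eps); lra).
  destruct (proj2 (is_lim_seq_spec _ _) (Hlimhalf (2 * K)) (mkposreal _ He)) as [N HN].
  specialize (HN N (le_n _)). simpl in HN. rewrite Rminus_0_r in HN.
  rewrite Rabs_pos_eq in HN by (pose proof (Hhalf N); nra).
  generalize (proj1 (filterlim_locally _ _) (Hphic N s) (mkposreal _ He)).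
  apply filter_imp. intros t Ht.
  change (Rabs (phi N t - phi N s) < eps / 3) in Ht. change (Rabs (psi t - psi s) < eps).
  pose proof (Hclose N s). pose proof (Hclose N t).
  replace (psi t - psi s) with ((psi t - phi N t) + (phi N t - phi N s) - (psi s - phi N s)) by ring.
  eapply Rle_lt_trans; [apply Rabs_triang|]. rewrite Rabs_Ropp.
  pose proof (Rabs_triang (psi t - phi N t) (phi N t - phi N s)). lra. }
assert (Hfix : forall s, psi s = T psi s).
{ intros s.
  (* Both [psi] and [T psi] are within K / 2^k of [phi (S k)]: the first by [Hclose], the second by
     contraction from [phi k]. *)
  assert (H : forall k, Rabs (psi s - T psi s) <= 2 * K * (/ 2) ^ k).
  { intros k. replace (psi s - T psi s) with ((psi s - phi (S k) s) - (T psi s - phi (S k) s)) by ring.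
    eapply Rle_trans; [apply Rabs_triang|]. rewrite Rabs_Ropp.
    pose proof (Hclose (S k) s).
    pose proof (HTl psi (phi k) _ Hpsic (Hphic k) (Hclose k) s) as H1.
    change (T (phi k) s) with (phi (S k) s) in H1.
    replace ((/ 2) ^ S k) with (/ 2 * (/ 2) ^ k) in H by reflexivity. lra. }
  assert (H0 : Rabs (psi s - T psi s) <= 0).
  { apply (is_lim_seq_le (fun _ => Rabs (psi s - T psi s)) (fun k => 2 * K * (/ 2) ^ k)
      (Finite (Rabs (psi s - T psi s))) (Finite 0)); [easy|apply is_lim_seq_const|apply Hlimhalf]. }
  pose proof (Rabs_pos (psi s - T psi s)).
  assert (psi s - T psi s = 0) by (apply Rabs_eq_0; lra). lra. }
exists psi. split; [|split].
- rewrite Hfix. unfold T. rewrite clamp_id by easy.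
  rewrite (RInt_point (V := R_CompleteNormedModule)). apply Rplus_0_r.
- intros s. rewrite Hfix. now apply HTb.
- intros s Hs.
  (* Strictly inside (-M, M) the clamp is the identity near [s], so [psi] is locally the unclamped
     integral. *)
  apply (is_derive_ext_loc (fun s => r0 + RInt (fun u => f u (psi u)) s0 s)).
  + assert (Hd : 0 < M - Rabs s) by lra.
    exists (mkposreal _ Hd). intros t Ht. change (Rabs (t - s) < M - Rabs s) in Ht.
    rewrite (Hfix t). unfold T. rewrite clamp_id; [easy|].
    replace t with ((t - s) + s) by ring. eapply Rle_trans; [apply Rabs_triang|]. lra.
  + evar_last.
    * apply (is_derive_plus (fun _ => r0)); [apply is_derive_const|].
      apply (is_derive_RInt_cont (fun u => f u (psi u))). now apply Hcont.
    * apply Rplus_0_l.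
Qed.

Lemma continuous_bounded (g : R -> R) (a b : R) :
  (forall s, continuous g s) ->
  exists G, 0 <= G /\ forall s, a <= s <= b -> Rabs (g s) <= G.
Proof.
intros Hg. destruct (Rle_dec a b) as [h|h].
- destruct (continuity_ab_maj (fun s => Rabs (g s)) a b h) as [x [Hx _]].
  + intros s _. apply continuity_pt_filterlim.
    apply (continuous_comp g Rabs); [apply Hg|apply continuous_Rabs].
  + exists (Rabs (g x)). split; [apply Rabs_pos|easy].
- exists 0. split; [lra|]. intros s Hs. lra.
Qed.

(** This is the reduced equation in the variable s = [P1bar]. The starting point [s0] is left free
    because [P1bar] equals -B at t = 0. Picard iteration is applied after truncating both the
    argument of [g] and the unknown. *)
Lemma small_solution (n : nat) (g : R -> R) (M : R) :
  (0 < n)%nat -> 0 < M -> (forall s, continuous g s) ->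
  exists eps, 0 < eps /\
    forall r0 s0, Rabs r0 < eps -> Rabs s0 <= M ->
    exists phi : R -> R, phi s0 = r0 /\
      forall s, Rabs s < M -> is_derive phi s (phi s ^ 2 + g s * phi s ^ S n).
Proof.
intros Hn HM Hg.
destruct (continuous_bounded g (- M) M Hg) as [G [HG0 HG]].
(* [d * N] will be a Lipschitz constant on [-d, d]: 2 d comes from the square, and (n+1) G d^n <=
   (n+1) G d from the other term, as n >= 1 and d <= 1. *)
set (N := 2 + INR (S n) * G).
assert (HN : 2 + G <= N).
{ unfold N. rewrite S_INR. pose proof (pos_INR n). nra. }
(* This gives 4 M (d N) <= 1 for the contraction, and with 1 + G <= N a displacement 2 M d^2 (1 + G)
   <= d / 2. Initial values below d / 2 then keep [phi] in [-d, d]. The summand 1 ensures d <= 1. *)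
set (d := / (4 * M * N + 1)).
assert (HMN : 0 <= M * N) by nra.
assert (Hd : 0 < d) by (apply Rinv_0_lt_compat; nra).
assert (Hd1 : d * (4 * M * N + 1) = 1) by (unfold d; field; nra).
assert (Hdle : d <= 1) by nra.
assert (Hpow : forall k, (0 < k)%nat -> 0 <= d ^ k <= d).
{ intros k Hk. destruct k as [|k]; [lia|].
  assert (0 <= d ^ k <= 1).
  { split; [apply pow_le; lra|]. rewrite <- (pow1 k). apply pow_incr. lra. }
  simpl. nra. }
exists (d / 2). split; [lra|]. intros r0 s0 Hr0 Hs0.
set (f := fun s x => clamp d x ^ 2 + g (clamp M s) * clamp d x ^ S n).
assert (Hcl : forall s, Rabs (g (clamp M s)) <= G).
{ intros s. apply HG. apply Rabs_le_between. apply clamp_bound. lra. }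
destruct (picard_clamped f M (d ^ 2 * (1 + G)) (d * N) s0 r0) as [phi [H0 [Hsm Hder]]].
- easy.
- pose proof (pow2_ge_0 d). nra.
- nra.
- nra.
- easy.
- intros phi Hphi s.
  assert (Hc : continuous (fun s => clamp d (phi s)) s).
  { apply (continuous_comp phi (clamp d)); [apply Hphi|apply continuous_clamp]. }
  apply (continuous_plus (fun s => clamp d (phi s) ^ 2)
          (fun s => g (clamp M s) * clamp d (phi s) ^ S n)).
  + now apply (continuous_pow (fun s => clamp d (phi s))).
  + apply (continuous_mult (fun s => g (clamp M s)) (fun s => clamp d (phi s) ^ S n)).
    * apply (continuous_comp (clamp M) g); [apply continuous_clamp|apply Hg].
    * now apply (continuous_pow (fun s => clamp d (phi s))).
- intros s x y. unfold f.
  pose proof (clamp_bound d x ltac:(lra)) as Hx. pose proof (clamp_bound d y ltac:(lra)) as Hy.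
  pose proof (pow_lipschitz 1 d _ _ Hx Hy) as H2. pose proof (pow_lipschitz n d _ _ Hx Hy) as Hn1.
  replace (clamp d x ^ 2 + g (clamp M s) * clamp d x ^ S n -
     (clamp d y ^ 2 + g (clamp M s) * clamp d y ^ S n))
   with ((clamp d x ^ 2 - clamp d y ^ 2) + g (clamp M s) * (clamp d x ^ S n - clamp d y ^ S n)) by ring.
  eapply Rle_trans; [apply Rabs_triang|]. rewrite Rabs_mult.
  set (D := Rabs (clamp d x - clamp d y)) in *.
  assert (HD : 0 <= D <= Rabs (x - y)) by (split; [apply Rabs_pos|apply clamp_lipschitz]).
  assert (Rabs (g (clamp M s)) * Rabs (clamp d x ^ S n - clamp d y ^ S n)
    <= G * (INR (S n) * d * D)).
  { apply Rmult_le_compat; try apply Rabs_pos; [apply Hcl|].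
    eapply Rle_trans; [apply Hn1|]. apply Rmult_le_compat_r; [easy|].
    apply Rmult_le_compat_l; [apply pos_INR|]. now apply Hpow. }
  apply Rle_trans with (d * N * D); [|apply Rmult_le_compat_l; [nra|easy]].
  unfold N. simpl (INR 2) in H2. rewrite pow_1 in H2. nra.
- intros s x. unfold f. pose proof (clamp_bound d x ltac:(lra)) as Hx.
  eapply Rle_trans; [apply Rabs_triang|]. rewrite Rabs_mult, <- !RPow_abs.
  pose proof (Rabs_pos (clamp d x)).
  assert (Hp : forall k, Rabs (clamp d x) ^ k <= d ^ k) by (intros k; apply pow_incr; lra).
  pose proof (Hp 2%nat).
  assert (Rabs (clamp d x) ^ S n <= d ^ 2).
  { eapply Rle_trans; [apply Hp|]. destruct n as [|n']; [lia|].
    simpl. rewrite Rmult_1_r. apply Rmult_le_compat_l; [lra|].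
    apply (Hpow (S n')). lia. }
  assert (Rabs (g (clamp M s)) * Rabs (clamp d x) ^ S n <= G * d ^ 2).
  { apply Rmult_le_compat; [apply Rabs_pos|apply pow_le, Rabs_pos|apply Hcl|easy]. }
  lra.
- exists phi. split; [easy|]. intros s Hs.
  specialize (Hder s Hs). unfold f in Hder.
  rewrite (clamp_id M s), (clamp_id d) in Hder; [easy| |lra].
  replace (phi s) with ((phi s - r0) + r0) by ring.
  eapply Rle_trans; [apply Rabs_triang|]. specialize (Hsm s).
  assert (2 * M * (d ^ 2 * (1 + G)) <= d / 2); [|lra].
  assert (M * (1 + G) <= M * N) by (apply Rmult_le_compat_l; lra). nra.
Qed.

(** * Polynomials and their integrals against vanishing moments *)

(* [h] agrees with a polynomial of degree less than [k], in Horner form. *)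
Fixpoint poly_lt (k : nat) (h : R -> R) : Prop :=
  match k with
  | O => forall x, h x = 0
  | S k => exists c q, poly_lt k q /\ forall x, h x = c + x * q x
  end.

Lemma poly_lt_lin (k : nat) (h1 h2 : R -> R) (a b : R) :
  poly_lt k h1 -> poly_lt k h2 -> poly_lt k (fun x => a * h1 x + b * h2 x).
Proof.
revert h1 h2. induction k as [|k IH]; simpl; intros h1 h2.
- intros H1 H2 x. rewrite H1, H2. ring.
- intros [c1 [q1 [Hq1 H1]]] [c2 [q2 [Hq2 H2]]].
  exists (a * c1 + b * c2), (fun x => a * q1 x + b * q2 x). split; [now apply IH|].
  intros x. rewrite H1, H2. ring.
Qed.

Lemma poly_lt_mulX (k : nat) (h : R -> R) :
  poly_lt k h -> poly_lt (S k) (fun x => x * h x).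
Proof. intros H. exists 0, h. split; [easy|]. intros x. ring. Qed.

Lemma poly_lt_S (k : nat) (h : R -> R) : poly_lt k h -> poly_lt (S k) h.
Proof.
revert h. induction k as [|k IH]; intros h H.
- exists 0, (fun _ => 0). split; [easy|]. intros x. rewrite (H x). ring.
- destruct H as [c [q [Hq H]]]. exists c, q. split; [now apply IH|easy].
Qed.

Lemma poly_lt_continuous (k : nat) (h : R -> R) :
  poly_lt k h -> forall x, continuous h x.
Proof.
revert h. induction k as [|k IH]; intros h H x.
- apply (continuous_ext (fun _ => 0)); [intros y; symmetry; apply H|apply continuous_const].
- destruct H as [c [q [Hq H]]].
  apply (continuous_ext (fun x => c + x * q x)); [intros y; symmetry; apply H|].
  apply (continuous_plus (fun _ => c)); [apply continuous_const|].
  apply (continuous_mult (fun x => x) q); [apply continuous_id|]. now apply (IH q).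
Qed.

Lemma RInt_ext_all (f g : R -> R) (u v : R) :
  (forall t, f t = g t) -> RInt f u v = RInt g u v.
Proof. intros H. apply RInt_ext. intros t _. apply H. Qed.

Lemma RInt_lin (f g : R -> R) (c u v : R) :
  (forall t, continuous f t) -> (forall t, continuous g t) ->
  RInt (fun t => c * f t + g t) u v = c * RInt f u v + RInt g u v.
Proof.
intros Hf Hg. apply is_RInt_unique.
apply (is_RInt_plus (fun t => c * f t) g).
- apply (is_RInt_scal f). apply (RInt_correct (V := R_CompleteNormedModule)). now apply ex_RInt_cont.
- apply (RInt_correct (V := R_CompleteNormedModule)). now apply ex_RInt_cont.
Qed.

Lemma RInt_eq0 (f : R -> R) (u v : R) : (forall t, f t = 0) -> RInt f u v = 0.
Proof.
intros H. apply is_RInt_unique. apply (is_RInt_ext (fun _ => 0)).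
- intros t _. now rewrite H.
- evar_last; [apply (is_RInt_const (V := R_NormedModule))|]. apply Rmult_0_r.
Qed.

(** Each Horner step splits off one moment. The power [b t ^ i] collects the factors already taken
    out, and [i + k <= N] keeps every moment that occurs below index [N]. *)
Lemma poly_lt_integral (N k i : nat) (h b F : R -> R) (u v : R) :
  (forall t, continuous b t) -> (forall t, continuous F t) ->
  (forall j, (j < N)%nat -> RInt (fun t => b t ^ j * F t) u v = 0) ->
  poly_lt k h -> (i + k <= N)%nat ->
  RInt (fun t => b t ^ i * h (b t) * F t) u v = 0.
Proof.
intros Hb HF Hm. revert h i. induction k as [|k IH]; intros h i H Hik.
- apply RInt_eq0. intros t. rewrite (H (b t)). ring.
- destruct H as [c [q [Hq H]]].
  assert (Hbi : forall j t, continuous (fun t => b t ^ j) t) by (intros; now apply continuous_pow).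
  assert (Hqb : forall t, continuous (fun t => q (b t)) t).
  { intros t. apply (continuous_comp b q); [apply Hb|now apply (poly_lt_continuous k)]. }
  transitivity (RInt (fun t => c * (b t ^ i * F t) + b t ^ S i * q (b t) * F t) u v).
  + apply RInt_ext_all. intros t. rewrite (H (b t)). simpl. ring.
  + rewrite RInt_lin.
    * rewrite Hm by lia. rewrite IH by (easy || lia).
      rewrite Rmult_0_r. apply Rplus_0_r.
    * intros t. apply (continuous_mult (fun t => b t ^ i) F); auto.
    * intros t. apply (continuous_mult (fun t => b t ^ S i * q (b t)) F); auto.
      apply (continuous_mult (fun t => b t ^ S i) (fun t => q (b t))); auto.
Qed.

(** * The trigonometric forms [P1] and [P1bar] *)

Lemma is_derive_P1bar (A B t : R) : is_derive (P1bar A B) t (P1 A B t).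
Proof. unfold P1bar, P1. auto_derive; [easy|ring]. Qed.

Lemma continuous_P1bar (A B t : R) : continuous (P1bar A B) t.
Proof. apply (ex_derive_continuous (P1bar A B)). eexists. apply is_derive_P1bar. Qed.

Lemma continuous_P1 (A B t : R) : continuous (P1 A B) t.
Proof.
apply (ex_derive_continuous (P1 A B)). unfold P1. auto_derive. easy.
Qed.

Lemma continuous_sum_f_R0 (f : nat -> R -> R) (m : nat) (t : R) :
  (forall i, continuous (f i) t) ->
  continuous (fun t => sum_f_R0 (fun i => f i t) m) t.
Proof.
intros Hf. induction m as [|m IH]; simpl; [apply Hf|].
now apply (continuous_plus (fun t => sum_f_R0 (fun i => f i t) m) (f (S m))).
Qed.

Lemma continuous_Pform (n : nat) (p : nat -> nat -> R) (t : R) :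
  continuous (Pform n p) t.
Proof.
unfold Pform.
apply (continuous_sum_f_R0 (fun i t => p i (n - i)%nat * cos t ^ i * sin t ^ (n - i))).
intros i. apply (ex_derive_continuous (fun t => p i (n - i)%nat * cos t ^ i * sin t ^ (n - i))).
auto_derive. easy.
Qed.

Lemma P1bar_periodic (A B t : R) : P1bar A B (t + 2 * PI) = P1bar A B t.
Proof. unfold P1bar. now rewrite sin_plus, cos_plus, sin_2PI, cos_2PI, !Rmult_1_r, !Rmult_0_r, Rplus_0_r, Rminus_0_r. Qed.

Lemma P1bar_bound (A B t : R) : Rabs (P1bar A B t) <= Rabs A + Rabs B.
Proof.
unfold P1bar. eapply Rle_trans; [apply Rabs_triang|]. rewrite Rabs_Ropp, !Rabs_mult.
assert (Rabs (sin t) <= 1) by (apply Rabs_le, SIN_bound).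
assert (Rabs (cos t) <= 1) by (apply Rabs_le, COS_bound).
pose proof (Rabs_pos A). pose proof (Rabs_pos B). nra.
Qed.

Lemma P1_P1bar_sqr (A B t : R) : P1 A B t ^ 2 = A ^ 2 + B ^ 2 - P1bar A B t ^ 2.
Proof.
unfold P1, P1bar. pose proof (sin2_cos2 t) as H. unfold Rsqr in H.
replace (A ^ 2 + B ^ 2) with ((A ^ 2 + B ^ 2) * (sin t * sin t + cos t * cos t)) by (rewrite H; ring).
ring.
Qed.

(** The integrand is the derivative of Phi([P1bar]), where Phi is a primitive of [phi], and [P1bar]
    returns to its initial value after one period. *)
Lemma RInt_P1_comp (A B : R) (phi : R -> R) :
  (forall x, continuous phi x) ->
  RInt (fun t => P1 A B t * phi (P1bar A B t)) 0 (2 * PI) = 0.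
Proof.
intros Hphi. apply is_RInt_unique.
set (Phi := fun x => RInt phi 0 x).
evar_last.
- apply (is_RInt_derive (fun t => Phi (P1bar A B t))).
  + intros t _. evar_last.
    * apply (is_derive_comp Phi (P1bar A B) t); [|apply is_derive_P1bar].
      apply is_derive_RInt_cont. exact Hphi.
    * reflexivity.
  + intros t _. apply (continuous_mult (P1 A B) (fun t => phi (P1bar A B t))).
    * apply continuous_P1.
    * apply (continuous_comp (P1bar A B) phi); [apply continuous_P1bar|apply Hphi].
- rewrite <- (Rplus_0_l (2 * PI)), P1bar_periodic. apply Rminus_diag.
Qed.

(** * Normal form of a trigonometric form in terms of [P1] and [P1bar] *)

(** Normal form modulo the relation [P1_P1bar_sqr], which eliminates squares of [P1]. The bound deg
    f <= k is the essential one: it matches the range of available moments. *)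
Definition rep (A B : R) (k : nat) (F : R -> R) : Prop :=
  exists f g, poly_lt (S k) f /\ poly_lt k g /\
    forall t, F t = f (P1bar A B t) + P1 A B t * g (P1bar A B t).

Lemma rep_ext (A B : R) (k : nat) (F G : R -> R) :
  (forall t, F t = G t) -> rep A B k F -> rep A B k G.
Proof.
intros E [f [g [Hf [Hg H]]]]. exists f, g. repeat split; auto. intros t. now rewrite <- E.
Qed.

Lemma rep_lin (A B : R) (k : nat) (F G : R -> R) (c d : R) :
  rep A B k F -> rep A B k G -> rep A B k (fun t => c * F t + d * G t).
Proof.
intros [f [g [Hf [Hg H]]]] [f' [g' [Hf' [Hg' H']]]].
exists (fun x => c * f x + d * f' x), (fun x => c * g x + d * g' x).
split; [|split]; [now apply poly_lt_lin..|].
intros t. rewrite H, H'. ring.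
Qed.

Lemma rep_mul_P1bar (A B : R) (k : nat) (F : R -> R) :
  rep A B k F -> rep A B (S k) (fun t => P1bar A B t * F t).
Proof.
intros [f [g [Hf [Hg H]]]].
exists (fun x => x * f x), (fun x => x * g x).
split; [|split]; [now apply poly_lt_mulX..|].
intros t. rewrite H. ring.
Qed.

(** Multiplication by [P1] swaps the two parts: [f] becomes the new cofactor of [P1], while P1^2 g
    turns into (A^2 + B^2 - x^2) g, whose degree is at most k + 1. *)
Lemma rep_mul_P1 (A B : R) (k : nat) (F : R -> R) :
  rep A B k F -> rep A B (S k) (fun t => P1 A B t * F t).
Proof.
intros [f [g [Hf [Hg H]]]].
exists (fun x => (A ^ 2 + B ^ 2) * g x + (-1) * (x * (x * g x))), f.
split; [|split].
- apply poly_lt_lin; [now do 2 apply poly_lt_S|now do 2 apply poly_lt_mulX].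
- easy.
- intros t. rewrite H. pose proof (P1_P1bar_sqr A B t).
  replace (A ^ 2 + B ^ 2) with (P1 A B t ^ 2 + P1bar A B t ^ 2) by lra. ring.
Qed.

(** With a = [P1] and b = [P1bar], inverting the linear system gives cos = (A a - B b) / (A^2 + B^2)
    and sin = (B a + A b) / (A^2 + B^2), so each factor cos or sin raises the degree by one. *)
Lemma rep_cos_sin (A B : R) (i j : nat) :
  A ^ 2 + B ^ 2 <> 0 -> rep A B (i + j) (fun t => cos t ^ i * sin t ^ j).
Proof.
intros HAB. pose proof HAB as HAB'. simpl in HAB'. induction i as [|i IH].
- induction j as [|j IH].
  + exists (fun _ => 1), (fun _ => 0). split; [|split]; [|easy|intros; simpl; ring].
    exists 1, (fun _ => 0). split; [easy|]. intros; ring.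
  + apply (rep_ext _ _ _ (fun t => B / (A ^ 2 + B ^ 2) * (P1 A B t * (cos t ^ 0 * sin t ^ j))
        + A / (A ^ 2 + B ^ 2) * (P1bar A B t * (cos t ^ 0 * sin t ^ j)))).
    * intros t. unfold P1, P1bar. simpl. field. now rewrite !Rmult_1_r in HAB'.
    * apply rep_lin; [now apply rep_mul_P1|now apply rep_mul_P1bar].
- apply (rep_ext _ _ _ (fun t => A / (A ^ 2 + B ^ 2) * (P1 A B t * (cos t ^ i * sin t ^ j))
        + - B / (A ^ 2 + B ^ 2) * (P1bar A B t * (cos t ^ i * sin t ^ j)))).
  + intros t. unfold P1, P1bar. simpl. field. now rewrite !Rmult_1_r in HAB'.
  + apply rep_lin; [now apply rep_mul_P1|now apply rep_mul_P1bar].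
Qed.

Lemma rep_Pform (A B : R) (n : nat) (p : nat -> nat -> R) :
  A ^ 2 + B ^ 2 <> 0 -> rep A B n (Pform n p).
Proof.
intros HAB. unfold Pform.
assert (Hi : forall i, (i <= n)%nat -> rep A B n (fun t => cos t ^ i * sin t ^ (n - i))).
{ intros i Hi. replace n with (i + (n - i))%nat at 1 by lia. now apply rep_cos_sin. }
assert (H : forall m, (m <= n)%nat -> rep A B n (fun t => sum_f_R0 (fun i => p i (n - i)%nat * cos t ^ i * sin t ^ (n - i)) m)).
{ induction m as [|m IH]; intros Hm.
  - apply (rep_ext _ _ _ (fun t => p 0%nat (n - 0)%nat * (cos t ^ 0 * sin t ^ (n - 0)) + 0 * (cos t ^ 0 * sin t ^ (n - 0)))).
    + intros t. simpl. ring.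
    + apply rep_lin; now apply Hi.
  - apply (rep_ext _ _ _ (fun t => 1 * sum_f_R0 (fun i => p i (n - i)%nat * cos t ^ i * sin t ^ (n - i)) m
      + p (S m) (n - S m)%nat * (cos t ^ S m * sin t ^ (n - S m)))).
    + intros t. rewrite tech5. ring.
    + apply rep_lin; [apply IH; lia|now apply Hi]. }
now apply H.
Qed.

(** * Sufficiency: vanishing moments give a center *)

(** The primitive [G] of h^2 is nondecreasing, and periodic because its increment over a period is
    0. Hence it is constant and its derivative h^2 vanishes. *)
Lemma periodic_sqr_integral_0 (h : R -> R) :
  (forall t, continuous h t) -> periodic_2PI h ->
  RInt (fun t => h t ^ 2) 0 (2 * PI) = 0 -> forall t, h t = 0.
Proof.
intros Hc Hper H0 t.
assert (Hc2 : forall t, continuous (fun t => h t ^ 2) t) by (intros; now apply continuous_pow).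
set (G := (fun t => RInt (fun t => h t ^ 2) 0 t) : R -> R).
assert (HG : forall s, is_derive G s (h s ^ 2)) by (intros s; now apply is_derive_RInt_cont).
assert (HGp : forall s, G (s + 2 * PI) = G s).
{ intros s. cut (G (s + 2 * PI) - G s = 0); [lra|].
  rewrite (is_derive_0_const (fun s => G (s + 2 * PI) - G s) 0 s).
  - rewrite Rplus_0_l. unfold G. rewrite H0.
    rewrite (RInt_point (V := R_CompleteNormedModule)). apply Rminus_diag.
  - intros u _. evar_last.
    + apply (is_derive_minus (fun s => G (s + 2 * PI)) G); [|apply HG].
      apply (is_derive_comp G (fun s => s + 2 * PI)); [apply HG|].
      auto_derive; [easy|reflexivity].
    + rewrite Hper. unfold minus, plus, opp, scal; simpl. unfold mult; simpl. ring. }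
assert (HGm : forall s u, s <= u -> G s <= G u).
{ intros s u Hsu. destruct (MVT_gen G s u (fun s => h s ^ 2)) as [c [_ Hmv]].
  - intros; apply HG.
  - intros; apply continuity_pt_filterlim. apply (ex_derive_continuous G). eexists. apply HG.
  - pose proof (pow2_ge_0 (h c)). nra. }
assert (Hder : is_derive G t 0).
{ apply (is_derive_ext_loc (fun _ => G t)); [|apply (is_derive_const (G t : R))].
  (* Since 2 PI > 2, both [s] and [t] lie between t - 1 and t - 1 + 2 PI, where [G] takes the same
     value; monotonicity does the rest. *)
  exists (mkposreal 1 Rlt_0_1). intros s Hs.
  change (Rabs (s - t) < 1) in Hs. apply Rabs_lt_between in Hs.
  pose proof PI2_3_2.
  assert (E : G (t - 1 + 2 * PI) = G (t - 1)) by apply HGp.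
  pose proof (HGm (t - 1) s ltac:(lra)). pose proof (HGm s (t - 1 + 2 * PI) ltac:(lra)).
  pose proof (HGm (t - 1) t ltac:(lra)). pose proof (HGm t (t - 1 + 2 * PI) ltac:(lra)).
  lra. }
assert (E : h t ^ 2 = 0).
{ rewrite <- (is_derive_unique _ _ _ (HG t)). now apply is_derive_unique. }
simpl in E. nra.
Qed.

Lemma moments_factor (n : nat) (A B : R) (p : nat -> nat -> R) :
  A ^ 2 + B ^ 2 <> 0 ->
  (forall j, (j <= n)%nat -> RInt (fun t => P1bar A B t ^ j * Pform n p t) 0 (2 * PI) = 0) ->
  exists g, (forall x, continuous g x) /\
    forall t, Pform n p t = P1 A B t * g (P1bar A B t).
Proof.
intros HAB Hm. destruct (rep_Pform A B n p HAB) as [f [g [Hf [Hg H]]]].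
pose proof (poly_lt_continuous _ _ Hf) as Hfc. pose proof (poly_lt_continuous _ _ Hg) as Hgc.
assert (Hfb : forall t, continuous (fun t => f (P1bar A B t)) t).
{ intros t. apply (continuous_comp (P1bar A B) f); [apply continuous_P1bar|apply Hfc]. }
exists g. split; [easy|].
(* All n + 1 moments enter here, since [f] may have degree n. *)
assert (H0 : RInt (fun t => P1bar A B t ^ 0 * f (P1bar A B t) * Pform n p t) 0 (2 * PI) = 0).
{ apply (poly_lt_integral (S n) (S n)); [apply continuous_P1bar|apply continuous_Pform| |easy|lia].
  intros j Hj. apply Hm. lia. }
assert (Hz : forall t, f (P1bar A B t) = 0).
{ apply (periodic_sqr_integral_0 (fun t => f (P1bar A B t))); [easy| |].
  - intros t. cbv beta. now rewrite P1bar_periodic.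
  - refine (eq_trans _ H0). symmetry.
    rewrite (RInt_ext_all (fun t => P1bar A B t ^ 0 * f (P1bar A B t) * Pform n p t)
       (fun t => 1 * f (P1bar A B t) ^ 2 + P1 A B t * (f (P1bar A B t) * g (P1bar A B t)))).
    + rewrite RInt_lin.
      * rewrite (RInt_P1_comp A B (fun x => f x * g x)).
        -- now rewrite Rmult_1_l, Rplus_0_r.
        -- intros x. now apply (continuous_mult f g).
      * intros t. now apply continuous_pow.
      * intros t. apply (continuous_mult (P1 A B)); [apply continuous_P1|].
        apply (continuous_mult (fun t => f (P1bar A B t)) (fun t => g (P1bar A B t))); [easy|].
        apply (continuous_comp (P1bar A B) g); [apply continuous_P1bar|apply Hgc].
    + intros t. rewrite H. simpl. ring. }
intros t. now rewrite H, Hz, Rplus_0_l.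
Qed.

Lemma factor_center (n : nat) (A B : R) (Q g : R -> R) :
  (0 < n)%nat -> (forall x, continuous g x) -> (forall t, continuous Q t) ->
  (forall t, Q t = P1 A B t * g (P1bar A B t)) ->
  is_center (abel_rhs n (P1 A B) Q).
Proof.
intros Hn Hg HQ H.
(* The summand 1 keeps [P1bar] strictly inside (-M, M), where [phi] is differentiable. *)
set (M := Rabs A + Rabs B + 1).
assert (HM : forall t, Rabs (P1bar A B t) < M) by (intros t; pose proof (P1bar_bound A B t); unfold M; lra).
assert (HM0 : 0 < M) by (eapply Rle_lt_trans; [apply Rabs_pos|apply (HM 0)]).
destruct (small_solution n g M Hn HM0 Hg) as [eps [Heps Hsol]].
exists eps. split; [easy|]. intros r0 Hr0.
destruct (Hsol r0 (P1bar A B 0) Hr0 (Rlt_le _ _ (HM 0))) as [phi [Hphi0 Hphi]].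
assert (Hs : is_solution (abel_rhs n (P1 A B) Q) (fun t => phi (P1bar A B t))).
{ intros t. evar_last.
  - apply (is_derive_comp phi (P1bar A B) t); [apply Hphi, HM|apply is_derive_P1bar].
  - unfold abel_rhs. rewrite H. unfold scal; simpl; unfold mult; simpl. ring. }
split.
- eexists. split; [exact Hs|exact Hphi0].
- intros r Hr Hr00 t.
  (* Periodicity is demanded of every solution with this initial value; uniqueness identifies each
     with the constructed one. *)
  assert (E : forall t, r t = phi (P1bar A B t)).
  { apply (solution_unique n (P1 A B) Q); [apply continuous_P1|easy|easy|easy|].
    now rewrite Hphi0. }
  now rewrite !E, P1bar_periodic.
Qed.

(** * Taylor expansion of (1 - x)^(-m) and comparison of coefficients *)

(** Induction from the geometric series: one more division by 1 - x replaces the coefficients by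
    their partial sums, so they stay positive. The sequence [c] is fixed before the order [N]. *)
Lemma taylor_inv_pow (m : nat) :
  exists c : nat -> R, (forall j, 0 < c j) /\
    forall N, exists K, 0 <= K /\ forall x, Rabs x <= / 2 ->
      Rabs ((/ (1 - x)) ^ S m - sum_f_R0 (fun j => c j * x ^ j) N) <= K * Rabs x ^ S N.
Proof.
assert (Hq : forall x, Rabs x <= / 2 -> 0 < 1 - x /\ Rabs (/ (1 - x)) <= 2).
{ intros x Hx. apply Rabs_le_between in Hx. split; [lra|].
  rewrite Rabs_pos_eq by (left; apply Rinv_0_lt_compat; lra).
  rewrite <- (Rinv_inv 2). apply Rinv_le_contravar; lra. }
induction m as [|m [c [Hc IH]]].
- exists (fun _ => 1). split; [intros; lra|]. intros N. exists 2. split; [lra|].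
  intros x Hx. destruct (Hq x Hx) as [Hx1 Hx2].
  assert (E : (1 - x) * sum_f_R0 (fun j => 1 * x ^ j) N = 1 - x ^ S N).
  { induction N as [|N IHN]; [simpl; ring|].
    rewrite tech5, Rmult_plus_distr_l, IHN. simpl. ring. }
  replace ((/ (1 - x)) ^ 1 - sum_f_R0 (fun j => 1 * x ^ j) N) with (/ (1 - x) * x ^ S N).
  + rewrite Rabs_mult, <- RPow_abs.
    apply Rmult_le_compat_r; [apply pow_le, Rabs_pos|easy].
  + replace (x ^ S N) with (1 - (1 - x) * sum_f_R0 (fun j => 1 * x ^ j) N) by lra.
    field. lra.
- exists (sum_f_R0 c). split.
  { intros j. apply tech1. auto. }
  intros N. destruct (IH N) as [K [HK HT]].
  assert (HcN : 0 < sum_f_R0 c N) by (apply tech1; auto).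
  (* The 2 bounds 1 / (1 - x) for |x| <= 1/2, and [sum_f_R0 c N] is the coefficient of x^(N+1) left
     over when (1 - x) T' telescopes. *)
  exists (2 * (K + sum_f_R0 c N)). split; [lra|].
  intros x Hx. destruct (Hq x Hx) as [Hx1 Hx2].
  specialize (HT x Hx).
  set (T := sum_f_R0 (fun j => c j * x ^ j) N) in *.
  set (T' := sum_f_R0 (fun j => sum_f_R0 c j * x ^ j) N).
  assert (E : (1 - x) * T' = T - sum_f_R0 c N * x ^ S N).
  { unfold T, T'. clear. induction N as [|N IHN]; [simpl; ring|].
    rewrite !(tech5 _ N), Rmult_plus_distr_l, IHN. simpl. ring. }
  replace ((/ (1 - x)) ^ S (S m) - T')
    with (/ (1 - x) * (((/ (1 - x)) ^ S m - T) + sum_f_R0 c N * x ^ S N)).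
  + rewrite Rabs_mult.
    pose proof (Rabs_triang ((/ (1 - x)) ^ S m - T) (sum_f_R0 c N * x ^ S N)) as Htr.
    rewrite (Rabs_mult _ (x ^ S N)), <- (RPow_abs x), (Rabs_pos_eq (sum_f_R0 c N)) in Htr by lra.
    replace (2 * (K + sum_f_R0 c N) * Rabs x ^ S N)
      with (2 * (K * Rabs x ^ S N + sum_f_R0 c N * Rabs x ^ S N)) by ring.
    apply Rmult_le_compat; try apply Rabs_pos; [easy|]. lra.
  + replace T with ((1 - x) * T' + sum_f_R0 c N * x ^ S N) by lra.
    rewrite <- (tech_pow_Rmult _ (S m)). field. lra.
Qed.

Lemma zero_of_le_linear (c K delta : R) :
  0 < delta -> (forall y, 0 < y < delta -> Rabs c <= K * y) -> c = 0.
Proof.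
intros Hd H. destruct (Req_dec c 0) as [|Hc]; [easy|exfalso].
apply Rabs_pos_lt in Hc.
set (L := Rabs K + 1). assert (HL : 0 < L) by (pose proof (Rabs_pos K); unfold L; lra).
set (y := Rmin (delta / 2) (Rabs c / (2 * L))).
assert (Hq : 0 < Rabs c / (2 * L)) by (apply Rdiv_lt_0_compat; lra).
assert (Hy : 0 < y < delta).
{ unfold y. split; [apply Rmin_glb_lt; lra|]. eapply Rle_lt_trans; [apply Rmin_l|lra]. }
specialize (H y Hy).
assert (y <= Rabs c / (2 * L)) by apply Rmin_r.
assert (L * y <= L * (Rabs c / (2 * L))) by (apply Rmult_le_compat_l; lra).
replace (L * (Rabs c / (2 * L))) with (Rabs c / 2) in * by (field; lra).
pose proof (Rle_abs K). unfold L in *. nra.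
Qed.

(** Letting [y] tend to 0 kills [d 0]; then a factor [y] cancels on both sides, and the shifted
    coefficients satisfy the bound for the smaller degree. *)
Lemma coefs_zero (n : nat) (d : nat -> R) (K delta : R) :
  0 < delta ->
  (forall y, 0 < y < delta -> Rabs (sum_f_R0 (fun j => d j * y ^ j) n) <= K * y ^ S n) ->
  forall j, (j <= n)%nat -> d j = 0.
Proof.
intros Hd. revert d. induction n as [|n IH]; intros d H j Hj.
- replace j with O by lia. apply (zero_of_le_linear _ K delta Hd).
  intros y Hy. specialize (H y Hy). simpl in H. now rewrite !Rmult_1_r in H.
- assert (E : forall y, sum_f_R0 (fun j => d j * y ^ j) (S n)
     = d O + y * sum_f_R0 (fun j => d (S j) * y ^ j) n).
  { intros y. rewrite decomp_sum by lia. simpl pred. rewrite scal_sum. f_equal.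
    - simpl. ring.
    - apply sum_eq. intros i _. simpl. ring. }
  set (S := sum_f_R0 (fun j => Rabs (d (Datatypes.S j))) n).
  assert (HS : forall y, 0 < y < 1 -> Rabs (sum_f_R0 (fun j => d (Datatypes.S j) * y ^ j) n) <= S).
  { intros y Hy. eapply Rle_trans; [apply Rsum_abs|]. apply sum_Rle. intros i _.
    rewrite Rabs_mult, <- RPow_abs, (Rabs_pos_eq y) by lra.
    assert (y ^ i <= 1) by (rewrite <- (pow1 i); apply pow_incr; lra).
    pose proof (Rabs_pos (d (Datatypes.S i))). nra. }
  assert (H0 : d O = 0).
  { apply (zero_of_le_linear _ (Rabs K + S) (Rmin delta 1)); [apply Rmin_glb_lt; lra|].
    intros y [Hy0 Hy].
    assert (y < delta) by (eapply Rlt_le_trans; [apply Hy|apply Rmin_l]).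
    assert (y < 1) by (eapply Rlt_le_trans; [apply Hy|apply Rmin_r]).
    specialize (H y ltac:(lra)). rewrite E in H. specialize (HS y ltac:(lra)).
    replace (d O) with ((d O + y * sum_f_R0 (fun j => d (Datatypes.S j) * y ^ j) n)
      - y * sum_f_R0 (fun j => d (Datatypes.S j) * y ^ j) n) by ring.
    eapply Rle_trans; [apply Rabs_triang|]. rewrite Rabs_Ropp, (Rabs_mult y), (Rabs_pos_eq y) by lra.
    assert (0 <= y ^ Datatypes.S n <= 1).
    { split; [apply pow_le; lra|]. rewrite <- (pow1 (Datatypes.S n)). apply pow_incr; lra. }
    assert (K * y ^ Datatypes.S (Datatypes.S n) <= Rabs K * y).
    { rewrite <- tech_pow_Rmult. pose proof (Rle_abs K). pose proof (Rabs_pos K).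
      apply Rle_trans with (Rabs K * (y * y ^ Datatypes.S n)).
      - apply Rmult_le_compat_r; [nra|easy].
      - apply Rmult_le_compat_l; [easy|nra]. }
    nra. }
  destruct j as [|j]; [easy|].
  apply (IH (fun j => d (Datatypes.S j))); [|lia].
  intros y Hy. specialize (H y Hy). rewrite E, H0, Rplus_0_l, Rabs_mult, Rabs_pos_eq in H by lra.
  rewrite <- tech_pow_Rmult in H. apply (Rmult_le_reg_l y); [easy|]. nra.
Qed.

(** * A priori estimates for small periodic solutions *)

(** Continuity argument: at the supremum [m] of the times up to which the weak bound holds, [Hb]
    gives the strict bound, which by continuity persists beyond [m]. *)
Lemma bootstrap_lt (f : R -> R) (T K : R) :
  (forall t, continuous f t) ->
  f 0 < K ->
  (forall t, 0 <= t <= T -> (forall s, 0 <= s <= t -> f s <= K) -> f t < K) ->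
  forall t, 0 <= t <= T -> f t < K.
Proof.
intros Hc H0 Hb t1 Ht1. destruct (Rlt_dec (f t1) K) as [|Hn]; [easy|exfalso].
(* Asking for the bound only at u < s puts 0 into [E] vacuously; the value at the supremum is
   recovered from the left by continuity. *)
set (E := fun s => 0 <= s <= t1 /\ forall u, 0 <= u < s -> f u <= K).
destruct (completeness E) as [m [Hub Hlub]].
- exists t1. intros s [Hs _]. lra.
- exists 0. split; [lra|]. intros u Hu. lra.
- assert (Hm0 : 0 <= m) by (apply Hub; split; [lra|]; intros u Hu; lra).
  assert (Hm1 : m <= t1) by (apply Hlub; intros s [Hs _]; lra).
  assert (Hle : forall u, 0 <= u < m -> f u <= K).
  { intros u Hu. destruct (Rle_dec (f u) K) as [|Hfu]; [easy|exfalso].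
    enough (m <= u) by lra. apply Hlub. intros s [Hs1 Hs2].
    destruct (Rle_dec s u) as [|Hsu]; [easy|]. specialize (Hs2 u ltac:(lra)). lra. }
  assert (Hfm : f m < K).
  { apply Hb; [lra|]. intros u Hu. destruct (Req_dec u m) as [->|]; [|apply Hle; lra].
    destruct (Rle_dec (f m) K) as [|Hfm]; [easy|exfalso].
    assert (He : 0 < f m - K) by lra.
    destruct (proj1 (filterlim_locally _ _) (Hc m) (mkposreal _ He)) as [eta Heta].
    pose proof (cond_pos eta) as Hpos.
    assert (Hm : 0 < m) by (destruct (Req_dec m 0) as [E0|]; [rewrite E0 in Hfm|]; lra).
    set (v := Rmax 0 (m - eta / 2)).
    assert (Hv : 0 <= v < m) by (split; [apply Rmax_l|apply Rmax_lub_lt; lra]).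
    assert (m - eta / 2 <= v) by apply Rmax_r.
    assert (Hball : ball m eta v).
    { change (Rabs (v - m) < eta). apply Rabs_lt_between. lra. }
    specialize (Heta v Hball). change (Rabs (f v - f m) < f m - K) in Heta.
    apply Rabs_lt_between in Heta. specialize (Hle v Hv). lra. }
  assert (He : 0 < K - f m) by lra.
  destruct (proj1 (filterlim_locally _ _) (Hc m) (mkposreal _ He)) as [eta Heta].
  pose proof (cond_pos eta) as Hpos.
  destruct (Req_dec m t1) as [->|Hne]; [lra|].
  set (s := Rmin t1 (m + eta)).
  assert (Hs : m < s) by (apply Rmin_glb_lt; lra).
  enough (s <= m) by lra. apply Hub. split; [split; [lra|apply Rmin_l]|].
  intros u Hu. destruct (Rlt_dec u m) as [|Hum]; [apply Hle; lra|].
  assert (Hus : u < m + eta) by (eapply Rlt_le_trans; [apply Hu|apply Rmin_r]).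
  assert (Hball : ball m eta u).
  { change (Rabs (u - m) < eta). rewrite Rabs_pos_eq; lra. }
  specialize (Heta u Hball). change (Rabs (f u - f m) < K - f m) in Heta.
  apply Rabs_lt_between in Heta. lra.
Qed.

(** With n = m + 1, passing to 1/r makes the quadratic term independent of [r]; only Q r^m, small
    for m >= 1, still involves it. *)
Lemma is_derive_inv_solution (m : nat) (P Q r : R -> R) (t : R) :
  is_solution (abel_rhs (S m) P Q) r -> 0 < r t ->
  is_derive (fun s => / r s) t (- (P t + Q t * r t ^ m)).
Proof.
intros Hr Hpos. evar_last.
- apply is_derive_inv; [apply Hr|lra].
- unfold abel_rhs. simpl. field. lra.
Qed.

(** While r <= 2 y <= 1, the derivative of 1/r is at least -2 D, so 1/r drops by at most 16 D over a
    period, as 2 PI <= 8. Adding the [D] in the initial condition, 1/r stays above 1/y - 17 D > 1/(2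
    y). *)
Lemma solution_small (m : nat) (P Q r : R -> R) (D y : R) :
  (forall t, continuous P t) -> (forall t, continuous Q t) ->
  (forall t, 0 <= t <= 2 * PI -> Rabs (P t) <= D /\ Rabs (Q t) <= D) ->
  is_solution (abel_rhs (S m) P Q) r -> 0 < r 0 ->
  0 < y -> 2 * y <= 1 -> / y - D <= / r 0 -> 17 * D < / (2 * y) ->
  forall t, 0 <= t <= 2 * PI -> r t < 2 * y.
Proof.
intros HP HQ HD Hr Hr0 Hy Hy1 Hini Hbig.
pose proof (solution_pos _ _ _ _ HP HQ Hr Hr0) as Hpos.
pose proof PI_4. pose proof PI_RGT_0.
assert (HD0 : 0 <= D).
{ apply Rle_trans with (Rabs (P 0)); [apply Rabs_pos|apply HD; lra]. }
assert (Hy2 : / y = 2 * / (2 * y)) by (field; lra).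
assert (Hlt : forall t, / (2 * y) < / r t -> r t < 2 * y).
{ intros t Ht. rewrite <- (Rinv_inv (r t)), <- (Rinv_inv (2 * y)).
  apply Rinv_lt_contravar; [|easy].
  apply Rmult_lt_0_compat; apply Rinv_0_lt_compat; [lra|apply Hpos]. }
apply bootstrap_lt.
- intros t. apply (solution_continuous _ _ _ Hr).
- apply Hlt. lra.
- intros t Ht Hs.
  destruct (MVT_gen (fun s => / r s) 0 t (fun s => - (P s + Q s * r s ^ m))) as [c [Hc E]].
  + intros s _. now apply is_derive_inv_solution.
  + intros s _. apply continuity_pt_filterlim. apply (ex_derive_continuous (fun s => / r s)).
    eexists. now apply is_derive_inv_solution.
  + rewrite Rmin_left, Rmax_right in Hc by lra.
    assert (Hrc : 0 <= r c ^ m <= 1).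
    { specialize (Hpos c). specialize (Hs c Hc). split; [apply pow_le; lra|].
      rewrite <- (pow1 m). apply pow_incr. lra. }
    destruct (HD c ltac:(lra)) as [HPc HQc].
    apply Rabs_le_between in HPc. apply Rabs_le_between in HQc.
    apply Hlt.
    assert (Q c * r c ^ m <= D) by nra.
    assert ((P c + Q c * r c ^ m) * t <= 2 * D * t) by (apply Rmult_le_compat_r; lra).
    assert (2 * D * t <= 2 * D * 8) by (apply Rmult_le_compat_l; lra).
    lra.
Qed.

(** The initial value is chosen so that w = 1/r + b starts exactly at 1/y. Periodicity gives the
    exact identity [Hint] with 1 + b r = w r, and replacing 1 + b r by 1/(1 - y b) costs O(y^(n+1))
    for n = m + 1, uniformly in [y] and [r]. *)
Lemma small_solution_estimate (k : nat) (P b Q : R -> R) (D : R) :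
  let m := S k in
  1 <= D ->
  (forall t, continuous Q t) -> (forall t, continuous P t) ->
  (forall t, is_derive b t (P t)) -> b (2 * PI) = b 0 ->
  (forall t, Rabs (b t) <= D) ->
  (forall t, 0 <= t <= 2 * PI -> Rabs (P t) <= D /\ Rabs (Q t) <= D) ->
  exists K, forall y r,
    0 < y -> 50 * D * y <= 1 ->
    is_solution (abel_rhs (S m) P Q) r -> r 0 = / (/ y - b 0) -> r (2 * PI) = r 0 ->
    Rabs (RInt (fun t => Q t * (/ (1 - y * b t)) ^ m) 0 (2 * PI)) <= K * y ^ S (S m).
Proof.
intros m HD1 HQ HP Hb Hbper HbD HD.
(* Factors: the length of the period, the bound on [Q], the Lipschitz constant m 2^(m-1) of x^m on
   [-2, 2], and the constant of [Hdb]. *)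
exists (2 * PI * (D * (INR m * 2 ^ k * (4 * D * (8 * D * 2 ^ m))))).
intros y r Hy HyD Hr Hr0 Hrper.
assert (Hbc : forall t, continuous b t).
{ intros t. apply (ex_derive_continuous b). eexists. apply Hb. }
pose proof PI_4 as HPI4. pose proof PI_RGT_0 as HPI0.
assert (Hy1 : 50 * y <= 1) by nra.
assert (HyD' : D <= / y / 50).
{ apply Rmult_le_reg_l with (50 * y); [lra|]. replace (50 * y * (/ y / 50)) with 1 by (field; lra). nra. }
assert (Hiy : 0 < / y) by (now apply Rinv_0_lt_compat).
assert (Hyb : forall t, Rabs (y * b t) <= / 50).
{ intros t. rewrite Rabs_mult, (Rabs_pos_eq y) by lra. specialize (HbD t). nra. }
assert (Hb' : forall t, - D <= b t <= D) by (intros t; apply Rabs_le_between, HbD).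
assert (Hr0pos : 0 < r 0).
{ rewrite Hr0. apply Rinv_0_lt_compat. specialize (Hb' 0). lra. }
pose proof (solution_pos _ _ _ _ HP HQ Hr Hr0pos) as Hpos.
assert (Hsmall : forall t, 0 <= t <= 2 * PI -> r t < 2 * y).
{ apply (solution_small m P Q r D y); auto.
  - lra.
  - rewrite Hr0, Rinv_inv. specialize (Hb' 0). lra.
  - replace (/ (2 * y)) with (/ y / 2) by (field; lra). lra. }
set (w := fun t => / r t + b t).
assert (Hw : forall t, is_derive w t (- (Q t * r t ^ m))).
{ intros t. evar_last.
  - apply (is_derive_plus (fun t => / r t) b); [now apply (is_derive_inv_solution m P Q)|apply Hb].
  - unfold plus; simpl. ring. }
assert (Hw0 : w 0 = / y).
{ unfold w. rewrite Hr0, Rinv_inv. ring. }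
assert (Hrc : forall t, continuous r t) by (intros t; apply (solution_continuous _ _ _ Hr)).
assert (Hwr : forall t, w t * r t = 1 + b t * r t).
{ intros t. unfold w. specialize (Hpos t). field. lra. }
assert (Hgc : forall t, continuous (fun t => Q t * (1 + b t * r t) ^ m) t).
{ intros t. apply (continuous_mult Q (fun t => (1 + b t * r t) ^ m)); [apply HQ|].
  apply (continuous_pow (fun t => 1 + b t * r t)).
  apply (continuous_plus (fun _ => 1)); [apply continuous_const|].
  now apply (continuous_mult b r). }
(* -w^(m+1) / (m+1) is a primitive of Q (w r)^m, and [w] agrees at the two ends of the period. *)
assert (Hint : RInt (fun t => Q t * (1 + b t * r t) ^ m) 0 (2 * PI) = 0).
{ apply is_RInt_unique. evar_last.
  - apply (is_RInt_derive (fun t => - / INR (S m) * w t ^ S m)); [|intros; apply Hgc].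
    intros t _. evar_last.
    + apply is_derive_scal. apply (is_derive_pow w (S m)). apply Hw.
    + rewrite <- Hwr, Rpow_mult_distr. simpl pred.
      assert (INR (S m) <> 0) by (apply not_0_INR; lia). field. easy.
  - unfold w. rewrite Hrper, Hbper. apply Rminus_diag. }
assert (Hpsi : forall t, continuous (fun t => Q t * (/ (1 - y * b t)) ^ m) t).
{ intros t. apply (continuous_mult Q (fun t => (/ (1 - y * b t)) ^ m)); [apply HQ|].
  apply (continuous_pow (fun t => / (1 - y * b t))).
  apply (ex_derive_continuous (fun t => / (1 - y * b t))).
  pose proof (Hb t) as Hbt. specialize (Hyb t). apply Rabs_le_between in Hyb.
  auto_derive. split; [eexists; apply Hbt|]. split; [lra|easy]. }
replace (RInt (fun t => Q t * (/ (1 - y * b t)) ^ m) 0 (2 * PI))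
  with (RInt (fun t => -1 * (Q t * (1 + b t * r t) ^ m) + Q t * (/ (1 - y * b t)) ^ m) 0 (2 * PI))
  by (rewrite RInt_lin by assumption; rewrite Hint, Rmult_0_r; apply Rplus_0_l).
eapply Rle_trans; [apply (abs_RInt_bound _ _ _ (D * (INR m * 2 ^ k * (4 * D * (8 * D * 2 ^ m))) * y ^ S (S m)))|].
- intros t. apply (continuous_plus (fun t => -1 * (Q t * (1 + b t * r t) ^ m)) (fun t => Q t * (/ (1 - y * b t)) ^ m)); [|apply Hpsi].
  apply (continuous_scal_r (-1) (fun t => Q t * (1 + b t * r t) ^ m)). apply Hgc.
- rewrite Rmin_left, Rmax_right by lra. intros t Ht.
  replace (-1 * (Q t * (1 + b t * r t) ^ m) + Q t * (/ (1 - y * b t)) ^ m)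
    with (Q t * ((/ (1 - y * b t)) ^ m - (1 + b t * r t) ^ m)) by ring.
  rewrite Rabs_mult, !(Rmult_assoc D).
  apply Rmult_le_compat; try apply Rabs_pos; [now apply HD|].
  pose proof (Hpos t) as Hpt. pose proof (Hsmall t Ht) as Hst.
  assert (Hyt : 49 / 50 <= 1 - y * b t <= 51 / 50).
  { specialize (Hyb t). apply Rabs_le_between in Hyb. lra. }
  assert (Hbt := HbD t).
  assert (Hq : 0 < / (1 - y * b t) <= 2).
  { split; [apply Rinv_0_lt_compat; lra|].
    rewrite <- (Rinv_inv 2). apply Rinv_le_contravar; lra. }
  assert (Hbr : Rabs (b t * r t) <= 1).
  { rewrite Rabs_mult, (Rabs_pos_eq (r t)) by lra. pose proof (Rabs_pos (b t)). nra. }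
  apply Rabs_le_between in Hbr.
  (* Mean value theorem with |w'| <= D (2 y)^m over a time at most 2 PI <= 8. *)
  assert (Hwt : Rabs (w t - / y) <= 8 * D * 2 ^ m * y ^ m).
  { rewrite <- Hw0.
    destruct (MVT_gen w 0 t (fun s => - (Q s * r s ^ m))) as [c [Hc E]].
    - intros; apply Hw.
    - intros s _. apply continuity_pt_filterlim. apply (ex_derive_continuous w).
      eexists. apply Hw.
    - rewrite Rmin_left, Rmax_right in Hc by lra.
      rewrite E, Rabs_mult, Rabs_Ropp, Rabs_mult, Rminus_0_r, (Rabs_pos_eq t) by lra.
      destruct (HD c ltac:(lra)) as [_ HQc].
      assert (Hrcm : 0 <= r c ^ m <= (2 * y) ^ m).
      { specialize (Hpos c). split; [apply pow_le; lra|]. apply pow_incr. split; [lra|].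
        left. apply Hsmall. lra. }
      rewrite Rpow_mult_distr in Hrcm.
      rewrite (Rabs_pos_eq (r c ^ m)) by lra.
      assert (Rabs (Q c) * r c ^ m <= D * (2 ^ m * y ^ m))
        by (apply Rmult_le_compat; [apply Rabs_pos|lra..]).
      assert (0 <= Rabs (Q c) * r c ^ m) by (apply Rmult_le_pos; [apply Rabs_pos|lra]).
      assert (Rabs (Q c) * r c ^ m * t <= D * (2 ^ m * y ^ m) * 8)
        by (apply Rmult_le_compat; lra).
      lra. }
  (* Both terms are values of 1/(1 - b v), at v = y and at v = 1/w. The prefactor b r y contributes
     two powers of [y] and w - 1/y another m. *)
  assert (Hdiff : / (1 - y * b t) - (1 + b t * r t) = b t * r t * (y * / (1 - y * b t)) * (w t - / y)).
  { unfold w. field. repeat split; lra. }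
  assert (Hdb : Rabs (/ (1 - y * b t) - (1 + b t * r t)) <= 4 * D * (8 * D * 2 ^ m) * y ^ S (S m)).
  { rewrite Hdiff, !Rabs_mult, (Rabs_pos_eq (r t)), (Rabs_pos_eq y), (Rabs_pos_eq (/ (1 - y * b t))) by lra.
    replace (4 * D * (8 * D * 2 ^ m) * y ^ S (S m)) with (D * (2 * y) * (y * 2) * (8 * D * 2 ^ m * y ^ m))
      by (simpl; ring).
    pose proof (Rabs_pos (b t)).
    apply Rmult_le_compat; [| apply Rabs_pos| |exact Hwt].
    - repeat apply Rmult_le_pos; lra.
    - apply Rmult_le_compat; [nra|nra| |nra]. apply Rmult_le_compat; lra. }
  eapply Rle_trans; [apply (pow_lipschitz k 2)|].
  + rewrite Rabs_pos_eq; lra.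
  + apply Rabs_le. lra.
  + rewrite (Rmult_assoc (INR m * 2 ^ k)). apply Rmult_le_compat_l; [|exact Hdb].
    apply Rmult_le_pos; [apply pos_INR|apply pow_le; lra].
- rewrite Rminus_0_r, (Rabs_pos_eq (2 * PI)) by lra. right. ring.
Qed.

(** * Necessity: a center forces the moments to vanish *)

Lemma RInt_weighted_sum (f : nat -> R -> R) (c : nat -> R) (N : nat) (u v : R) :
  (forall j t, continuous (f j) t) ->
  RInt (fun t => sum_f_R0 (fun j => c j * f j t) N) u v
    = sum_f_R0 (fun j => c j * RInt (f j) u v) N.
Proof.
intros Hf.
assert (Hcf : forall j t, continuous (fun t => c j * f j t) t).
{ intros j t. apply (continuous_scal_r (c j) (f j)). apply Hf. }
induction N as [|N IH].
- simpl. rewrite <- (Rplus_0_r (c O * _)), <- (RInt_eq0 (fun _ => 0) u v) by easy.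
  rewrite <- RInt_lin; [|apply Hf|intros; apply continuous_const].
  apply RInt_ext_all. intros t. ring.
- rewrite tech5, <- IH, Rplus_comm, <- RInt_lin.
  + apply RInt_ext_all. intros t. rewrite tech5. ring.
  + apply Hf.
  + intros t. now apply (continuous_sum_f_R0 (fun j t => c j * f j t)).
Qed.

Lemma center_moments (n : nat) (A B : R) (Q : R -> R) :
  (1 < n)%nat -> (forall t, continuous Q t) ->
  is_center (abel_rhs n (P1 A B) Q) ->
  forall j, (j <= n)%nat -> RInt (fun t => P1bar A B t ^ j * Q t) 0 (2 * PI) = 0.
Proof.
intros Hn HQ [eps [Heps Hcenter]].
destruct n as [|[|k]]; [lia|lia|].
pose proof PI_RGT_0 as HPI.
destruct (continuous_bounded Q 0 (2 * PI) HQ) as [DQ [HDQ0 HDQ]].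
destruct (continuous_bounded (P1 A B) 0 (2 * PI) (continuous_P1 A B)) as [DP [HDP0 HDP]].
pose proof (Rabs_pos A) as HA. pose proof (Rabs_pos B) as HB.
set (D := 1 + Rabs A + Rabs B + DQ + DP).
assert (HbD : forall t, Rabs (P1bar A B t) <= D).
{ intros t. pose proof (P1bar_bound A B t). unfold D. lra. }
destruct (small_solution_estimate k (P1 A B) (P1bar A B) Q D) as [K HK].
- unfold D. lra.
- easy.
- apply continuous_P1.
- apply is_derive_P1bar.
- rewrite <- (Rplus_0_l (2 * PI)). apply P1bar_periodic.
- easy.
- intros t Ht. specialize (HDQ t Ht). specialize (HDP t Ht). unfold D. lra.
- set (b := P1bar A B) in *.
  destruct (taylor_inv_pow k) as [c [Hc HT]]. destruct (HT (S (S k))) as [KT [HKT HTx]].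
  assert (HD : 1 <= D) by (unfold D; lra).
  (* The initial value is y / (1 - y b(0)) < 2 y, so y < eps / 2 puts it in the range of the center;
     the other bound is the one required by the estimate. *)
  set (delta := Rmin (eps / 2) (/ (50 * D))).
  assert (Hdelta : 0 < delta).
  { apply Rmin_glb_lt; [lra|]. apply Rinv_0_lt_compat. lra. }
  assert (Hbc : forall t, continuous b t) by (intros; apply continuous_P1bar).
  (* The constant adds the error [K] of the estimate to the Taylor remainder: |y b| <= D y, the
     bound |Q| <= D and the length 2 PI. *)
  assert (Hz : forall j, (j <= S (S k))%nat -> c j * RInt (fun t => b t ^ j * Q t) 0 (2 * PI) = 0).
  { apply (coefs_zero (S (S k)) (fun j => c j * RInt (fun t => b t ^ j * Q t) 0 (2 * PI))
      (K + 2 * PI * (D * (KT * D ^ S (S (S k))))) delta Hdelta).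
    intros y [Hy Hyd].
    assert (Hyeps : y < eps / 2) by (eapply Rlt_le_trans; [apply Hyd|apply Rmin_l]).
    assert (HyD : 50 * D * y <= 1).
    { apply Rle_trans with (50 * D * / (50 * D)); [|right; field; lra].
      apply Rmult_le_compat_l; [lra|]. left. eapply Rlt_le_trans; [apply Hyd|apply Rmin_r]. }
    assert (Hyb : forall t, Rabs (y * b t) <= / 50).
    { intros t. rewrite Rabs_mult, (Rabs_pos_eq y) by lra. specialize (HbD t). nra. }
    pose proof (Hyb 0) as Hyb0. apply Rabs_le_between in Hyb0.
    assert (E0 : / (/ y - b 0) = y * / (1 - y * b 0)) by (field; split; lra).
    assert (Hq : 0 < / (1 - y * b 0) < 2).
    { split; [apply Rinv_0_lt_compat; lra|]. rewrite <- (Rinv_inv 2). apply Rinv_lt_contravar; lra. }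
    destruct (Hcenter (/ (/ y - b 0))) as [[r [Hr Hr0]] Hper].
    { rewrite E0, Rabs_pos_eq by nra. nra. }
    assert (Hrper : r (2 * PI) = r 0).
    { rewrite <- (Rplus_0_l (2 * PI)). now apply (Hper r). }
    specialize (HK y r Hy HyD Hr Hr0 Hrper).
    assert (Hcphi : forall t, continuous (fun t => Q t * (/ (1 - y * b t)) ^ S k) t).
    { intros t. apply (continuous_mult Q (fun t => (/ (1 - y * b t)) ^ S k)); [apply HQ|].
      apply (continuous_pow (fun t => / (1 - y * b t))).
      apply (ex_derive_continuous (fun t => / (1 - y * b t))).
      pose proof (is_derive_P1bar A B t) as Hbt. specialize (Hyb t). apply Rabs_le_between in Hyb.
      auto_derive. split; [eexists; apply Hbt|]. split; [lra|easy]. }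
    set (f := fun j t => y ^ j * (b t ^ j * Q t)).
    assert (Hfc : forall j t, continuous (f j) t).
    { intros j t. apply (continuous_scal_r (y ^ j) (fun t => b t ^ j * Q t)).
      apply (continuous_mult (fun t => b t ^ j) Q); [now apply continuous_pow|apply HQ]. }
    assert (Hsum : sum_f_R0 (fun j => c j * RInt (fun t => b t ^ j * Q t) 0 (2 * PI) * y ^ j) (S (S k))
      = RInt (fun t => sum_f_R0 (fun j => c j * f j t) (S (S k))) 0 (2 * PI)).
    { rewrite RInt_weighted_sum by easy. apply sum_eq. intros j _.
      rewrite (RInt_ext_all (f j) (fun t => y ^ j * (b t ^ j * Q t) + 0)) by (intros; unfold f; ring).
      rewrite RInt_lin.
      - rewrite (RInt_eq0 (fun _ => 0)) by easy. rewrite Rplus_0_r. now rewrite (Rmult_comm (y ^ j)), Rmult_assoc.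
      - intros t. apply (continuous_mult (fun t => b t ^ j) Q); [now apply continuous_pow|apply HQ].
      - intros; apply continuous_const. }
    assert (Hdiff : Rabs (RInt (fun t => -1 * (Q t * (/ (1 - y * b t)) ^ S k)
        + sum_f_R0 (fun j => c j * f j t) (S (S k))) 0 (2 * PI))
      <= 2 * PI * (D * (KT * D ^ S (S (S k)) * y ^ S (S (S k))))).
    { rewrite <- (Rabs_pos_eq (2 * PI)) at 2 by lra. rewrite <- (Rminus_0_r (2 * PI)) at 2.
      apply abs_RInt_bound.
      - intros t. apply (continuous_plus (fun t => -1 * (Q t * (/ (1 - y * b t)) ^ S k))
            (fun t => sum_f_R0 (fun j => c j * f j t) (S (S k)))).
        + apply (continuous_scal_r (-1) (fun t => Q t * (/ (1 - y * b t)) ^ S k)). apply Hcphi.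
        + apply (continuous_sum_f_R0 (fun j t => c j * f j t)).
          intros j. apply (continuous_scal_r (c j) (f j)). apply Hfc.
      - rewrite Rmin_left, Rmax_right by lra. intros t Ht.
        replace (sum_f_R0 (fun j => c j * f j t) (S (S k)))
          with (Q t * sum_f_R0 (fun j => c j * (y * b t) ^ j) (S (S k))).
        + replace (-1 * (Q t * (/ (1 - y * b t)) ^ S k) + Q t * sum_f_R0 (fun j => c j * (y * b t) ^ j) (S (S k)))
            with (- (Q t * ((/ (1 - y * b t)) ^ S k - sum_f_R0 (fun j => c j * (y * b t) ^ j) (S (S k))))) by ring.
          rewrite Rabs_Ropp, Rabs_mult.
          specialize (HDQ t Ht). specialize (Hyb t).
          apply Rmult_le_compat; try apply Rabs_pos; [unfold D; lra|].
          eapply Rle_trans; [apply HTx; lra|]. rewrite Rmult_assoc.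
          apply Rmult_le_compat_l; [easy|]. rewrite <- Rpow_mult_distr.
          apply pow_incr. split; [apply Rabs_pos|].
          rewrite Rabs_mult, (Rabs_pos_eq y), Rmult_comm by lra.
          apply Rmult_le_compat_r; [lra|apply HbD].
        + rewrite scal_sum. apply sum_eq. intros j _. unfold f. rewrite Rpow_mult_distr. ring. }
    rewrite RInt_lin in Hdiff.
    - rewrite Hsum.
      set (I1 := RInt (fun t => Q t * (/ (1 - y * b t)) ^ S k) 0 (2 * PI)) in *.
      set (I2 := RInt (fun t => sum_f_R0 (fun j => c j * f j t) (S (S k))) 0 (2 * PI)) in *.
      replace (I2 : R) with (I1 + (-1 * I1 + I2)) by (generalize (I1 : R), (I2 : R); intros; ring).
      eapply Rle_trans; [apply Rabs_triang|]. lra.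
    - apply Hcphi.
    - intros t. apply (continuous_sum_f_R0 (fun j t => c j * f j t)).
      intros j. apply (continuous_scal_r (c j) (f j)). apply Hfc. }
  (* Positivity of [c j] allows it to be cancelled, leaving the moment itself. *)
  intros j Hj. specialize (Hz j Hj). specialize (Hc j).
  apply Rmult_integral in Hz. destruct Hz as [Hz|Hz]; [lra|exact Hz].
Qed.

Theorem theorem2p1
  (n : nat) (hn : (0 < n)%nat)
  (A B : R) (hAB : A ^ 2 + B ^ 2 <> 0)
  (p : nat -> nat -> R)
  (* for n = 1 the symbols P_1 and P_n denote the same form *)
  (hp : n = 1%nat -> p 1%nat 0%nat = A /\ p 0%nat 1%nat = B) :
  is_center (fun t r => r * (P1 A B t * r + Pform n p t * r ^ n)) <->
  (forall j : nat, (j <= n)%nat ->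
     RInt (fun t => P1bar A B t ^ j * Pform n p t) 0 (2 * PI) = 0).
Proof.
split.
- intros Hc. destruct (Nat.eq_dec n 1) as [->|Hn].
  + destruct (hp eq_refl) as [hA hB]. intros j _.
    refine (eq_trans _ (RInt_P1_comp A B (fun x => x ^ j) _)).
    * apply RInt_ext_all. intros t. unfold P1, Pform. simpl. rewrite hA, hB. ring.
    * intros x. apply (continuous_pow (fun x => x)). apply continuous_id.
  + apply center_moments; [lia|apply continuous_Pform|exact Hc].
- intros Hm. destruct (moments_factor n A B p hAB Hm) as [g [Hg HP]].
  apply (factor_center n A B (Pform n p) g hn Hg); [apply continuous_Pform|exact HP].
Qed.
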